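(* Let $(P,\leq)=(P,\land,\lor)$ be a lattice in which every principal order ideal $\{y\in P: y\le x\}$ is finite, and let $f:P\to\mathbb{C}$ be semimultiplicative with $f(x)\neq 0$ for all $x\in P$. Let $S=\{x_1,\ldots,x_n\}$ be a meet closed subset of $P$ with distinct elements, indexed so that $x_i<x_j\Rightarrow i<j$, and put $S_i=\{x_1,\ldots,x_i\}$. Let $2\le i\le n$ and suppose that $$\Big(\tfrac{1}{f}*_S\mu_S\Big)(x_i)=\sum_{y\in S,\ y\le x_i}\frac{\mu_S(y,x_i)}{f(y)}\neq 0 .$$ Then the join matrix $[S_i]_f$ is invertible if and only if $[S_{i-1}]_f$ is invertible.
   Context: $f$ is semimultiplicative if $f(x)f(y)=f(x\land y)f(x\lor y)$ for all $x,y\in P$. A subset $S$ is meet closed if $x,y\in S\Rightarrow x\land y\in S$. For a finite set $T=\{y_1,\ldots,y_m\}\subseteq P$, the join matrix $[T]_f$ is the $m\times m$ matrix with $(i,j)$ entry $f(y_i\lor y_j)$. $\mu_S$ denotes the Möbius function of the finite poset $(S,\le)$: $\mu_S(x,x)=1$, $\mu_S(x,y)=-\sum_{z\in S,\,x\le z<y}\mu_S(x,z)$ for $x<y$, and $\mu_S(x,y)=0$ if $x\not\le y$. *)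

(* Defs.v *)
From HB Require Import structures.
From mathcomp Require Import all_boot all_order all_algebra finmap.
From mathcomp Require Import complex.
From mathcomp Require Import all_classical all_reals.
Set Implicit Arguments.
Unset Strict Implicit.
Unset Printing Implicit Defensive.
Import Order.TTheory GRing.Theory Num.Theory.
Local Open Scope ring_scope.

Definition semimultiplicative (d : Order.disp_t) (P : latticeType d)
    (K : comNzRingType) (f : P -> K) : Prop :=
  forall x y, f x * f y = f (Order.meet x y) * f (Order.join x y).

Definition fset_meet_closed (d : Order.disp_t) (P : latticeType d)
    (S : {fset P}) : Prop :=
  forall x y, x \in S -> y \in S -> Order.meet x y \in S.

Definition join_mx (d : Order.disp_t) (P : latticeType d) (K : comNzRingType)
    (f : P -> K) (m : nat) (y : 'I_m -> P) : 'M[K]_m :=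
  \matrix_(i, j) f (Order.join (y i) (y j)).

(* [k] is recursion fuel: by [moebius_rec_fuel], any [k] larger than the
   number of z in S with x <= z < y gives the same value. *)
Fixpoint moebius_rec (d : Order.disp_t) (P : porderType d) (S : {fset P})
    (k : nat) (x y : P) : int :=
  if k is k'.+1 then
    if x == y then 1
    else if (x < y)%O then
      - \sum_(z <- S | (x <= z < y)%O) moebius_rec S k' x z
    else 0
  else 0.

(* The Moebius function of the finite poset S; [moebiusxx], [moebius_lt] and
   [moebius_nle] are its defining equations. *)
Definition moebius (d : Order.disp_t) (P : porderType d) (S : {fset P})
    (x y : P) : int :=
  moebius_rec S #|` S|.+1 x y.

Lemma count_itv_lt (d : Order.disp_t) (P : porderType d) (S : {fset P})
    (x y z : P) :
  z \in S -> (x <= z < y)%O ->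
  (count (fun t => (x <= t < z)%O) S < count (fun t => (x <= t < y)%O) S)%N.
Proof.
move=> zS /andP[xz zy].
have /= := count_predUI (pred1 z) (fun t => (x <= t < z)%O) S.
rewrite [X in (_ + X)%N](_ : _ = 0%N); last first.
  apply/eqP; rewrite -leqn0 leqNgt -has_count; apply/hasPn => t _ /=.
  by case: eqP => //= ->; rewrite ltxx andbF.
rewrite addn0 => E.
apply: (@leq_trans (count (predU (pred1 z) (fun t => (x <= t < z)%O)) S)).
  by rewrite E -[X in (X <= _)%N]add1n leq_add2r -has_count has_pred1.
apply: sub_count => t /= /predU1P[->|/andP[-> tz]]; first by rewrite xz.
by rewrite (lt_trans tz).
Qed.

Lemma moebius_rec_fuel (d : Order.disp_t) (P : porderType d) (S : {fset P})
    (k1 k2 : nat) (x y : P) :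
  (count (fun z => (x <= z < y)%O) S < k1)%N ->
  (count (fun z => (x <= z < y)%O) S < k2)%N ->
  moebius_rec S k1 x y = moebius_rec S k2 x y.
Proof.
elim: k1 k2 y => [|k1 IH] [|k2] y //= h1 h2.
case: eqP => // _; case: ifP => // _; congr (- _).
rewrite big_seq_cond [RHS]big_seq_cond.
apply: eq_bigr => z /andP[zS xzy]; have lt_c := count_itv_lt zS xzy.
by apply: IH; apply: leq_trans lt_c _.
Qed.

Lemma moebiusxx (d : Order.disp_t) (P : porderType d) (S : {fset P}) (x : P) :
  moebius S x x = 1.
Proof. by rewrite /moebius /= eqxx. Qed.

Lemma moebius_lt (d : Order.disp_t) (P : porderType d) (S : {fset P})
    (x y : P) :
  (x < y)%O ->
  moebius S x y = - \sum_(z <- S | (x <= z < y)%O) moebius S x z.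
Proof.
move=> xy; rewrite {1}/moebius /= lt_eqF // xy; congr (- _).
rewrite big_seq_cond [RHS]big_seq_cond.
apply: eq_bigr => z /andP[zS xzy]; have lt_c := count_itv_lt zS xzy.
by apply: moebius_rec_fuel; [apply: leq_trans lt_c _ | rewrite ltnS];
  exact: count_size.
Qed.

Lemma moebius_nle (d : Order.disp_t) (P : porderType d) (S : {fset P})
    (x y : P) :
  ~~ (x <= y)%O -> moebius S x y = 0.
Proof.
move=> nxy; rewrite /moebius /=; case: eqP nxy => [->|_ nxy].
  by rewrite lexx.
by case: ifP => // /ltW xy; rewrite xy in nxy.
Qed.

(* Main.v *)
Require Import Defs.
From HB Require Import structures.
From mathcomp Require Import all_boot all_order all_algebra finmap.
From mathcomp Require Import complex.
From mathcomp Require Import all_classical all_reals.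
Set Implicit Arguments.
Unset Strict Implicit.
Unset Printing Implicit Defensive.
Import Order.TTheory GRing.Theory Num.Theory.
Local Open Scope ring_scope.

(** Semimultiplicativity gives [f (x \/ y) = f x * f y / f (x /\ y)], so the
    join matrix of [f] is a diagonal congruence of the meet matrix of [1 / f].
    By Moebius inversion the meet matrix factors as [E *m D *m E^T] with [E] the
    unitriangular incidence matrix of the order and [D] the diagonal of the
    values of [(1 / f) *_S mu_S].  Passing from [S_(i-1)] to [S_i] therefore
    multiplies the determinant by [f (x_i) ^+ 2 * ((1 / f) *_S mu_S) (x_i)]. *)

Definition moebius_conv (d : Order.disp_t) (P : porderType d)
    (K : pzRingType) (S : {fset P}) (g : P -> K) (z : P) : K :=
  \sum_(y <- S | (y <= z)%O) (moebius S y z)%:~R * g y.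

(** For [x < y] the term at [z = y] cancels all the others, by the recursion [moebius_lt]. *)
Lemma sum_moebius (d : Order.disp_t) (P : porderType d) (S : {fset P})
    (x y : P) :
  y \in S -> (x <= y)%O ->
  \sum_(z <- S | (x <= z <= y)%O) moebius S x z = (x == y)%:R.
Proof.
move=> yS xy.
rewrite big_mkcond (bigD1_seq y) ?fset_uniq //= xy lexx /= -big_mkcondr /=.
rewrite (eq_bigl (fun z => (x <= z < y)%O)) => [|z]; last first.
  by rewrite lt_neqAle; case: (x <= z)%O; rewrite ?andbF.
move: xy; rewrite le_eqVlt => /predU1P[->|xy].
  rewrite moebiusxx eqxx big1 ?addr0 // => z /andP[yz zy].
  by have := le_lt_trans yz zy; rewrite ltxx.
by rewrite moebius_lt // addNr lt_eqF.
Qed.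

(** After the sums are exchanged, the coefficient of [g y] is a sum of [moebius S y z] over
    [y <= z <= w], which vanishes unless [y = w]. *)
Lemma moebius_inversion (d : Order.disp_t) (P : porderType d) (K : pzRingType)
    (S : {fset P}) (g : P -> K) (w : P) :
  w \in S -> \sum_(z <- S | (z <= w)%O) moebius_conv S g z = g w.
Proof.
move=> wS; rewrite /moebius_conv.
rewrite (exchange_big_dep (fun y => (y <= w)%O)) /=; last first.
  by move=> z y zw yz; exact: le_trans zw.
rewrite (eq_bigr (fun y => (y == w)%:R * g y)) => [|y yw]; last first.
  rewrite -mulr_suml; congr (_ * _).
  have -> : (y == w)%:R = (y == w)%:R%:~R :> K by rewrite natz -pmulrn.
  rewrite -(sum_moebius wS yw) rmorph_sum /=; apply: eq_bigl => z.
  by rewrite andbC.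
rewrite big_mkcond (bigD1_seq w) ?fset_uniq //= lexx eqxx mul1r big1 ?addr0 //.
by move=> y /negPf->; rewrite mul0r if_same.
Qed.

(** Carries Moebius sums over [S] to sums over matrix indices. *)
Lemma sum_lower_set (d : Order.disp_t) (P : porderType d) (K : nmodType)
    (S : {fset P}) (m : nat) (y : 'I_m -> P) (h : P -> K) (w : P) :
  injective y -> (forall j, y j \in S) ->
  (forall z, z \in S -> (z <= w)%O -> exists j, z = y j) ->
  \sum_(z <- S | (z <= w)%O) h z = \sum_(j | (y j <= w)%O) h (y j).
Proof.
move=> y_inj yS wlow.
rewrite -big_filter -[RHS](big_map y (fun z => (z <= w)%O) h).
rewrite -[RHS]big_filter; apply: perm_big; apply: uniq_perm.
- by rewrite filter_uniq ?fset_uniq.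
- by rewrite filter_uniq // map_inj_uniq ?index_enum_uniq.
move=> z; rewrite !mem_filter; case: (boolP (z <= w)%O) => //= zw.
apply/idP/mapP => [zS|[j _ ->] //].
by have [j ->] := wlow z zS zw; exists j; rewrite ?mem_index_enum.
Qed.

(** The family [y] lists a lower set of [S], so that one and the same [moebius S] serves both [S_i]
    and [S_(i-1)]. *)
Lemma det_join_mx (d : Order.disp_t) (P : latticeType d) (K : fieldType)
    (f : P -> K) (S : {fset P}) (m : nat) (y : 'I_m -> P) :
  semimultiplicative f -> (forall z, f z != 0) -> fset_meet_closed S ->
  injective y -> (forall j, y j \in S) ->
  (forall z j, z \in S -> (z <= y j)%O -> exists k, z = y k) ->
  (forall j k, (y j < y k)%O -> (j < k)%N) ->
  \det (join_mx f y) =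
  \prod_j (f (y j) ^+ 2 * moebius_conv S (fun z => (f z)^-1) (y j)).
Proof.
move=> fM f0 SM y_inj yS ylow y_lt.
set h := moebius_conv _ _.
pose E : 'M[K]_m := \matrix_(j, k) ((y k <= y j)%O)%:R.
pose F : 'rV[K]_m := \row_j f (y j).
pose H : 'rV[K]_m := \row_j h (y j).
have detE : \det E = 1.
  rewrite det_trig; first by rewrite big1 // => j _; rewrite mxE lexx.
  apply/is_trig_mxP => j k jk; rewrite mxE le_eqVlt; case: eqP => [/y_inj kj|_].
    by rewrite kj ltnn in jk.
  case: (boolP (y k < y j)%O) => // /y_lt kj.
  by have := ltn_trans jk kj; rewrite ltnn.
have -> : join_mx f y =
    diag_mx F *m (E *m diag_mx H *m E^T) *m diag_mx F.
  apply/matrixP => j k; rewrite mul_mx_diag mul_diag_mx !mxE.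
  (* The sum runs over the [y l] below both [y j] and [y k], that is, below their meet; the meet is
     in [S], so inversion applies there. *)
  have -> : \sum_l (E *m diag_mx H) j l * E^T l k = (f (y j `&` y k)%O)^-1.
    rewrite -(moebius_inversion (fun z => (f z)^-1) (SM _ _ (yS j) (yS k))).
    rewrite (sum_lower_set _ y_inj yS) => [|z zS]; last first.
      by rewrite lexI => /andP[zj _]; exact: ylow zS zj.
    rewrite [RHS]big_mkcond; apply: eq_bigr => l _.
    rewrite mul_mx_diag !mxE lexI -/h.
    by case: (_ <= _)%O; case: (_ <= _)%O; rewrite ?(mul0r, mulr0, mul1r, mulr1).
  by rewrite mulrAC fM mulrAC mulfV ?mul1r.
rewrite !det_mulmx det_tr detE !det_diag mulr1 mul1r -!big_split /=.
by apply: eq_bigr => j _; rewrite !mxE mulrAC -expr2.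
Qed.

(* Indices start at 0: x_1, ..., x_n of the text are x 0, ..., x (n-1), so the
   element called x_i there is [x i] with i : 'I_n and 0 < i; the matrices of
   its S_i and S_(i-1) are those of the first i.+1 and the first i terms. *)
Theorem theorem3p1 (R : realType) (d : Order.disp_t) (P : latticeType d)
    (hP : forall x : P, finite_set [set y : P | (y <= x)%O]%classic)
    (f : P -> R[i])
    (hf : semimultiplicative f)
    (hf0 : forall x : P, f x != 0)
    (S : {fset P}) (hS : fset_meet_closed S)
    (n : nat) (x : 'I_n -> P)
    (x_inj : injective x)
    (xS : forall y : P, y \in S <-> exists j : 'I_n, y = x j)
    (x_lt : forall j k : 'I_n, (x j < x k)%O -> (j < k)%N)
    (i : 'I_n) (hi : (0 < i)%N)
    (hmu : \sum_(y <- S | (y <= x i)%O) (moebius S y (x i))%:~R / f y != 0) :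
  join_mx f (fun j : 'I_i.+1 => x (widen_ord (ltn_ord i) j)) \in unitmx <->
  join_mx f (fun j : 'I_i => x (widen_ord (ltnW (ltn_ord i)) j)) \in unitmx.
Proof.
have xinS j : x j \in S by apply/xS; exists j.
pose c k := f (x k) ^+ 2 * moebius_conv S (fun z => (f z)^-1) (x k).
have det m (mn : (m <= n)%N) :
    \det (join_mx f (fun j : 'I_m => x (widen_ord mn j))) =
    \prod_(j < m) c (widen_ord mn j).
  apply: det_join_mx => // [j k /x_inj /(congr1 val) /= jk|z j /xS[k ->] kj|j k].
  - exact: val_inj.
  (* An element of [S] below [x j] has index at most [j], so the first [m] terms form a lower
     set. *)
  - have km : (k < m)%N.
      apply: leq_ltn_trans (ltn_ord j); move: kj; rewrite le_eqVlt.
      by case/predU1P => [/x_inj->|/x_lt /ltnW].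
    by exists (Ordinal km); congr x; exact: val_inj.
  - by move/x_lt.
rewrite !unitmxE !unitfE !det big_ord_recr /= mulf_eq0 negb_or.
rewrite (_ : widen_ord (ltn_ord i) ord_max = i); last exact: val_inj.
(* The second factor of [c i] is the sum in [hmu]. *)
have ci : c i != 0 by rewrite mulf_neq0 ?expf_neq0.
rewrite ci andbT (eq_bigr (c \o widen_ord (ltnW (ltn_ord i)))) // => j _.
by congr c; exact: val_inj.
Qed.
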